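(* Let $n\ge1$ and let $W\subseteq\mathbb{R}^{n+1}_1$ be any vector subspace. Then: (a) $\dim W+\dim W^{\perp}=n+1$. (b) For any group $\Gamma<{\bf O}(n,1)$, $W$ is nondegenerate and $\Gamma$-invariant if, and only if, its orthogonal subspace $W^{\perp}$ is a $\Gamma$-invariant complement of $W$, that is, $W^\perp$ is $\Gamma$-invariant and $W\oplus W^{\perp}=\mathbb{R}^{n+1}_1$.
   Context: Minkowski space $\mathbb{R}^{n+1}_1$ is $\mathbb{R}^{n+1}$ with the pseudo inner product $\langle x,y\rangle=x^tJy=\sum_{i=1}^n x_iy_i-x_{n+1}y_{n+1}$, where $J=\mathrm{diag}(1,\dots,1,-1)$ ($n$ ones). The Lorentz group ${\bf O}(n,1)=\{A\in GL(n+1,\mathbb{R}):A^tJA=J\}$ acts by matrix multiplication. $W^\perp=\{x\in\mathbb{R}^{n+1}_1:\langle x,w\rangle=0\ \forall w\in W\}$ is the orthogonal subspace with respect to the pseudo inner product. $W$ is nondegenerate if the restriction of $\langle\cdot,\cdot\rangle$ to $W$ is a nondegenerate bilinear form. $W$ is $\Gamma$-invariant if $\gamma x\in W$ for all $\gamma\in\Gamma$, $x\in W$. *)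

(* Defs.v *)
From HB Require Import structures.
From mathcomp Require Import all_boot all_order all_algebra.
From mathcomp Require Import classical_sets reals.
Set Implicit Arguments.
Unset Strict Implicit.
Unset Printing Implicit Defensive.
Import GRing.Theory.
Local Open Scope classical_set_scope.
Local Open Scope ring_scope.

Section Minkowski.
Variables (R : realType) (n : nat).

(* The time-like coordinate is the last one, of index [ord_max : 'I_n.+1]. *)
Definition minkowski_mx : 'M[R]_n.+1 :=
  diag_mx (\row_(i < n.+1) if i == ord_max then -1 else 1).

Definition minkowski_form (x y : 'cV[R]_n.+1) : R :=
  (x^T *m minkowski_mx *m y) 0 0.

Lemma minkowski_formE (x y : 'cV[R]_n.+1) :
  minkowski_form x y =
  \sum_(i < n) x (widen_ord (leqnSn n) i) 0 * y (widen_ord (leqnSn n) i) 0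
  - x ord_max 0 * y ord_max 0.
Proof.
rewrite /minkowski_form mul_mx_diag mxE big_ord_recr /= !mxE eqxx mulrN1 mulNr.
congr (_ - _); apply: eq_bigr => i _; rewrite !mxE ifN ?mulr1 //.
by rewrite -val_eqE /= ltn_eqF.
Qed.

Lemma minkowski_form_bilinear :
  bilinear_for (GRing.Scale.Law.clone _ _ ( *%R ) _)
    (GRing.Scale.Law.clone _ _ (idfun \; *%R ) _) minkowski_form.
Proof.
rewrite /minkowski_form; split => [u|u] a x y /=.
- by rewrite linearP /= !mulmxDl -!scalemxAl !mxE.
- by rewrite mulmxDr -scalemxAr !mxE.
Qed.

HB.instance Definition _ := bilinear_isBilinear.Build R _ _ _
  (GRing.Scale.Law.clone _ _ ( *%R ) _)
  (GRing.Scale.Law.clone _ _ (idfun \; *%R ) _)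
  minkowski_form minkowski_form_bilinear.

Lemma minkowski_form_sym (x y : 'cV[R]_n.+1) :
  minkowski_form x y = (-1) ^+ false * idfun (minkowski_form y x).
Proof.
rewrite expr0 mul1r /= !minkowski_formE mulrC; congr (_ - _).
by apply: eq_bigr => i _; rewrite mulrC.
Qed.

HB.instance Definition _ := @isHermitianSesquilinear.Build R _ false idfun
  minkowski_form minkowski_form_sym.

(* [orthov] is MathComp's orthogonal subspace with respect to a form. *)
Definition perp (W : {vspace 'cV[R]_n.+1}) : {vspace 'cV[R]_n.+1} :=
  orthov minkowski_form W.

Lemma mem_perpP (W : {vspace 'cV[R]_n.+1}) (x : 'cV[R]_n.+1) :
  reflect {in W, forall w, minkowski_form x w = 0} (x \in perp W).
Proof. exact: mem_orthovP. Qed.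

Definition restricted_form (W : {vspace 'cV[R]_n.+1}) (u v : subvs_of W) : R :=
  minkowski_form (vsval u) (vsval v).

Lemma restricted_form_bilinear (W : {vspace 'cV[R]_n.+1}) :
  bilinear_for (GRing.Scale.Law.clone _ _ ( *%R ) _)
    (GRing.Scale.Law.clone _ _ (idfun \; *%R ) _) (@restricted_form W).
Proof.
rewrite /restricted_form; split => [u|u] a x y /=.
- by have /= <- := minkowski_form_bilinear.1 (vsval u) a (vsval x) (vsval y).
- by have /= <- := minkowski_form_bilinear.2 (vsval u) a (vsval x) (vsval y).
Qed.

HB.instance Definition _ (W : {vspace 'cV[R]_n.+1}) :=
  bilinear_isBilinear.Build R _ _ _
  (GRing.Scale.Law.clone _ _ ( *%R ) _)
  (GRing.Scale.Law.clone _ _ (idfun \; *%R ) _)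
  (@restricted_form W) (restricted_form_bilinear W).

HB.instance Definition _ (W : {vspace 'cV[R]_n.+1}) :=
  @isHermitianSesquilinear.Build R _ false idfun (@restricted_form W)
    (fun u v => minkowski_form_sym (vsval u) (vsval v)).

Definition nondegenerate_on (W : {vspace 'cV[R]_n.+1}) : bool :=
  nondegenerate (@restricted_form W).

Lemma nondegenerate_onP (W : {vspace 'cV[R]_n.+1}) :
  reflect {in W, forall x, {in W, forall y, minkowski_form x y = 0} -> x = 0}
    (nondegenerate_on W).
Proof.
apply: (iffP eqP) => [rad0 x xW x0|H].
  have: vsproj W x \in orthov (@restricted_form W) fullv.
    apply/mem_orthovP => v _ /=.
    by rewrite /restricted_form vsprojK // x0 // subvsP.
  by rewrite rad0 memv0 => /eqP/(congr1 vsval); rewrite vsprojK.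
apply/eqP; rewrite -subv0; apply/subvP => u /mem_orthovP u0.
rewrite memv0 -val_eqE /=; apply/eqP/H; first exact: subvsP.
move=> y yW; have /= := u0 (vsproj W y) (memvf _).
by rewrite /restricted_form vsprojK.
Qed.

Definition lorentz_group : set 'M[R]_n.+1 :=
  [set A | A \in unitmx /\ A^T *m minkowski_mx *m A = minkowski_mx].

Definition lorentz_subgroup (Gamma : set 'M[R]_n.+1) : Prop :=
  [/\ Gamma `<=` lorentz_group,
      Gamma 1%:M,
      (forall A B, Gamma A -> Gamma B -> Gamma (A *m B)) &
      (forall A, Gamma A -> Gamma (invmx A))].

Definition invariant_under (Gamma : set 'M[R]_n.+1)
    (W : {vspace 'cV[R]_n.+1}) : Prop :=
  forall A x, Gamma A -> x \in W -> A *m x \in W.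

End Minkowski.

(* Main.v *)
(* Nondegeneracy of the form gives dim W + dim W^perp = n + 1, hence
   (W^perp)^perp = W.  Since the elements of Gamma are isometries, the
   orthogonal of a Gamma-invariant subspace is Gamma-invariant; applied to W and
   to W^perp, this makes the two invariance conditions equivalent, while W is
   nondegenerate exactly when W meets W^perp trivially. *)
Require Import Defs.
From mathcomp Require Import all_boot all_order all_algebra.
From mathcomp Require Import classical_sets reals.
Import GRing.Theory.
Local Open Scope ring_scope.

Section OrthovDim.
Variables (F : fieldType) (eps : bool) (theta : {rmorphism F -> F}).
Variables (vT : vectType F) (form : {hermitian vT for eps & theta}).
Implicit Types U V W : {vspace vT}.

Lemma orthov_add U V : orthov form (U + V) = (orthov form U :&: orthov form V)%VS.
Proof. by apply/vspaceP => x; rewrite memv_cap !memvE orthovD.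
Qed.

(** Each vector of a basis of [V] imposes one linear condition on [U], costing at most one
    dimension. *)
Lemma leq_dim_cap_orthov U V :
  (\dim U <= \dim (U :&: orthov form V) + \dim V)%N.
Proof.
rewrite -[X in (_ + X)%N](size_tuple (vbasis V)).
rewrite -[V in orthov _ V](span_basis (vbasisP V)).
(* [U] is generalised: the induction hypothesis is applied to its intersection with the orthogonal
   of [v]. *)
elim: (tval (vbasis V)) U => [|v s IHs] U.
  by rewrite span_nil orthov0 capvf addn0.
rewrite span_cons orthov_add capvA /= addnS.
have := leq_dim_orthov1 form v U; rewrite -subn1 leq_subLR add1n => /leq_trans.
by apply; rewrite ltnS.
Qed.

(* The upper bound comes from [orthov V :&: orthov V^C = orthov fullv = 0]. *)
Lemma dim_orthov V :
  nondegenerate form -> (\dim V + \dim (orthov form V))%N = \dim {:vT}.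
Proof.
move=> /eqP ndf; apply/eqP; rewrite eqn_leq; apply/andP; split.
  have := leq_dim_cap_orthov (orthov form V) V^C.
  rewrite -orthov_add addv_complf ndf dimv0 add0n dimv_compl => le_dim.
  by rewrite -(subnKC (dimvS (subvf V))) leq_add2l.
by have := leq_dim_cap_orthov fullv V; rewrite capfv addnC.
Qed.

(** [V] lies in its double orthogonal, and [dim_orthov], used twice, equates their dimensions. *)
Lemma orthovK V : nondegenerate form -> orthov form (orthov form V) = V.
Proof.
move=> ndf; apply/esym/eqP; rewrite eqEdim -orthov_sym subvv /=.
rewrite -(leq_add2l (\dim (orthov form V))) dim_orthov //.
by rewrite addnC dim_orthov.
Qed.

End OrthovDim.

Section Minkowski.
Variables (R : realType) (n : nat).
Implicit Types (W : {vspace 'cV[R]_n.+1}) (Gamma : set 'M[R]_n.+1).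

Lemma minkowski_mx_sqr :
  @minkowski_mx R n *m minkowski_mx R n = 1%:M.
Proof.
rewrite /minkowski_mx mulmx_diag -diag_const_mx; congr diag_mx.
by apply/rowP => i; rewrite !mxE; case: ifP; rewrite ?mulrNN mulr1.
Qed.

Lemma minkowski_nondegenerate : nondegenerate (@minkowski_form R n).
Proof.
rewrite /nondegenerate -subv0; apply/subvP => x /mem_orthovP x0.
(* Since J is its own inverse, it suffices that x^T J = 0; its entries are the pairings of [x] with
   the standard basis. *)
rewrite memv0 -(inj_eq trmx_inj) -[x^T]mulmx1 -minkowski_mx_sqr mulmxA trmx0.
suff -> : x^T *m minkowski_mx R n = 0 by rewrite mul0mx.
apply/rowP => j; have := x0 (delta_mx j 0) (memvf _).
by rewrite /= /minkowski_form -colE mxE => ->; rewrite mxE.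
Qed.

(** The adjoint of a Lorentz matrix is its inverse: write y = A (A^-1 y) and use A^T J A = J. *)
Lemma minkowski_form_invmx (A : 'M[R]_n.+1) x y : lorentz_group A ->
  minkowski_form (A *m x) y = minkowski_form x (invmx A *m y).
Proof.
move=> [uA AJA]; rewrite -{1}(mulKVmx uA y) /minkowski_form -[in RHS]AJA.
by rewrite trmx_mul !mulmxA.
Qed.

Lemma invariant_perp Gamma W : lorentz_subgroup Gamma ->
  invariant_under Gamma W -> invariant_under Gamma (perp W).
Proof.
move=> [sub _ _ GV] invW A x GA /mem_perpP xW; apply/mem_perpP => w wW.
rewrite minkowski_form_invmx; last exact: sub.
(* Closure of [Gamma] under inverses keeps A^-1 w in [W]. *)
by apply: xW; apply: invW => //; apply: GV.
Qed.

Lemma perpK W : perp (perp W) = W.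
Proof. exact: orthovK minkowski_nondegenerate. Qed.

Lemma dim_perp W : (\dim W + \dim (perp W))%N = n.+1.
Proof.
by rewrite dim_orthov ?minkowski_nondegenerate // dimvf /dim /= muln1.
Qed.

(** The intersection is the radical of the form restricted to [W]. *)
Lemma nondegenerate_on_cap W :
  nondegenerate_on W = (W :&: perp W == 0)%VS.
Proof.
apply/nondegenerate_onP/eqP => [ndW | W0 x xW x0].
  apply/eqP; rewrite -subv0; apply/subvP => x /memv_capP[xW /mem_perpP x0].
  by rewrite memv0 (ndW x).
by apply/eqP; rewrite -memv0 -W0 memv_cap xW; apply/mem_perpP.
Qed.

Lemma addv_perp W : (W :&: perp W = 0)%VS -> (W + perp W = fullv)%VS.
Proof.
move=> W0; apply/eqP; rewrite eqEdim subvf dimv_disjoint_sum // dim_perp.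
by rewrite dimvf /dim /= muln1.
Qed.

End Minkowski.

Theorem proposition3p2 (R : realType) (n : nat) (hn : (1 <= n)%N)
    (W : {vspace 'cV[R]_n.+1}) :
  (\dim W + \dim (perp W) = n.+1)%N /\
  (forall Gamma : set 'M[R]_n.+1, lorentz_subgroup Gamma ->
    (nondegenerate_on W /\ invariant_under Gamma W <->
     invariant_under Gamma (perp W) /\
     directv (W + perp W) /\ (W + perp W)%VS = fullv)).
Proof.
split=> [|Gamma GL]; first exact: dim_perp.
rewrite nondegenerate_on_cap; split=> [[/eqP W0 invW]|[invW [/directv_addP W0 _]]].
  split; first exact: invariant_perp.
  by split; [exact/directv_addP | exact: addv_perp].
by split; [exact/eqP | rewrite -[W]perpK; exact: invariant_perp].
Qed.
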